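(* Let $K$ be a field and let $n\ge 1$ be an integer. Then the join-meet ideal $I_{O_n}\subset K[O_n]$ is a radical ideal.
   Context: For a finite lattice $L$ and a field $K$, $K[L]$ denotes the polynomial ring over $K$ whose variables $x_a$ are indexed by the elements $a\in L$. The join-meet ideal of $L$ is $I_L=(\{x_ax_b-x_{a\vee b}x_{a\wedge b}\mid a,b\in L\})\subset K[L]$. For an integer $n\ge 1$, $O_n$ is the finite lattice on the $2n+2$ distinct elements $\{s,a_1,\dots,a_n,b_1,\dots,b_n,t\}$ whose partial order is generated by the relations $s<a_1<\cdots<a_n<t$, $s<b_1<\cdots<b_n<t$, together with the relations $a_i<b_{i+1}$ for every odd $i$ with $1\le i$ and $i+1\le n$, and $b_{i+1}<a_{i+2}$ for every odd $i$ with $1\le i$ and $i+2\le n$. *)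

(* Defs.v *)
From HB Require Import structures.
From mathcomp Require Import all_boot all_order all_algebra.
From mathcomp Require Import zify.
From mathcomp Require Import mpoly.

Set Implicit Arguments.
Unset Strict Implicit.
Unset Printing Implicit Defensive.

Import Order.TTheory GRing.Theory.

Section Ideals.
Local Open Scope ring_scope.

Definition generated_ideal (R : comNzRingType) (I : finType) (g : I -> R)
    (p : R) : Prop :=
  exists c : I -> R, p = \sum_i c i * g i.

Definition radical (R : comNzRingType) (J : R -> Prop) (p : R) : Prop :=
  exists2 k : nat, (0 < k)%N & J (p ^+ k).

Definition is_radical (R : comNzRingType) (J : R -> Prop) : Prop :=
  forall p : R, radical J p <-> J p.

(** K[L] is [{mpoly K[#|L|]}]; the variable x_a is the one whose index is the
    rank of a in the enumeration of L. *)
Definition latvar (K : fieldType) (L : finType) (a : L) : {mpoly K[#|L|]} :=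
  'X_(enum_rank a).

Definition join_meet_gen (K : fieldType) d (L : finLatticeType d)
    (ab : L * L) : {mpoly K[#|L|]} :=
  latvar K ab.1 * latvar K ab.2
  - latvar K (ab.1 `|` ab.2)%O * latvar K (ab.1 `&` ab.2)%O.

Definition join_meet_ideal (K : fieldType) d (L : finLatticeType d) :
    {mpoly K[#|L|]} -> Prop :=
  generated_ideal (@join_meet_gen K d L).

End Ideals.
Arguments join_meet_ideal K {d} L _.

(** Ordinals count from 0, so [Oa i] and [Ob i] stand for a_{i+1} and
    b_{i+1}. *)
Inductive latO (n : nat) : Type :=
  | Os
  | Oa of 'I_n
  | Ob of 'I_n
  | Ot.
Arguments Os {n}.
Arguments Ot {n}.

Section LatOFinite.
Variable n : nat.

Definition latO_code (x : latO n) : option (option ('I_n + 'I_n)) :=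
  match x with
  | Os => None
  | Ot => Some None
  | Oa i => Some (Some (inl i))
  | Ob i => Some (Some (inr i))
  end.

Definition latO_decode (u : option (option ('I_n + 'I_n))) : latO n :=
  match u with
  | None => Os
  | Some None => Ot
  | Some (Some (inl i)) => Oa i
  | Some (Some (inr i)) => Ob i
  end.

Lemma latO_codeK : cancel latO_code latO_decode.
Proof. by case. Qed.

HB.instance Definition _ := Equality.copy (latO n) (can_type latO_codeK).
HB.instance Definition _ := Choice.copy (latO n) (can_type latO_codeK).
HB.instance Definition _ := Countable.copy (latO n) (can_type latO_codeK).
HB.instance Definition _ := Finite.copy (latO n) (can_type latO_codeK).

Lemma card_latO : #|{: latO n}| = 2 * n + 2.
Proof.
rewrite (bij_eq_card (f := latO_code)); last first.
  by exists latO_decode; [exact: latO_codeK | case=> [[[]|]|]].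
by rewrite !card_option card_sum card_ord; lia.
Qed.

End LatOFinite.

Section LatOOrder.
Variable n : nat.
Implicit Types (x y z : latO n) (i j : 'I_n).

Let ix i : nat := i.+1.

(** Each chain s < ... < t enters through its
    consecutive pairs. When n = 0 both chains reduce to s < t. *)
Definition latO_gen : rel (latO n) := fun x y =>
  match x, y with
  | Os, Oa j => ix j == 1
  | Os, Ob j => ix j == 1
  | Os, Ot => n == 0
  | Oa i, Oa j => ix j == (ix i).+1
  | Ob i, Ob j => ix j == (ix i).+1
  | Oa i, Ot => ix i == n
  | Ob i, Ot => ix i == n
  (* a_k < b_{k+1} for odd k *)
  | Oa i, Ob j => odd (ix i) && (ix j == (ix i).+1)
  (* b_{k+1} < a_{k+2} for odd k *)
  | Ob i, Oa j => ~~ odd (ix i) && (ix j == (ix i).+1)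
  | _, _ => false
  end.

Definition latO_le : rel (latO n) := connect latO_gen.

(** Explicit form of [latO_le]: to go from a_k up to the other chain one must
    first reach the least odd index >= k, and from b_k the least even one. *)
Definition latO_leb : rel (latO n) := fun x y =>
  match x, y with
  | Os, _ => true
  | _, Ot => true
  | Oa i, Oa j => ix i <= ix j
  | Ob i, Ob j => ix i <= ix j
  | Oa i, Ob j => ix i + ~~ odd (ix i) < ix j
  | Ob i, Oa j => ix i + odd (ix i) < ix j
  | _, _ => false
  end.

Lemma latO_leb_refl : reflexive latO_leb.
Proof. by case=> //= i. Qed.

Lemma latO_leb_trans : transitive latO_leb.
Proof.
by move=> [|i|i|] [|j|j|] [|k|k|] //=; rewrite /ix; lia.
Qed.

Lemma latO_leb_anti : antisymmetric latO_leb.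
Proof.
move=> [|i|i|] [|j|j|] //= /andP[]; rewrite /ix; try lia.
  by move=> ? ?; congr Oa; apply: val_inj => /=; lia.
by move=> ? ?; congr Ob; apply: val_inj => /=; lia.
Qed.

Lemma latO_gen_leb x y : latO_gen x y -> latO_leb x y.
Proof. by case: x y => [|i|i|] [|j|j|] //=; rewrite /ix; lia. Qed.

Lemma latO_chain (c : 'I_n -> latO n) :
  (forall i j, ix j == (ix i).+1 -> latO_gen (c i) (c j)) ->
  forall i j, i <= j -> latO_le (c i) (c j).
Proof.
move=> gen_c i [j ltjn]; elim: j ltjn => [|j IHj] ltjn /= leij.
  suff -> : i = Ordinal ltjn by apply: connect0.
  by apply: val_inj => /=; lia.
case: (ltngtP (val i) j.+1) leij => [lt_ij _||eq_ij _] //; last first.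
  suff -> : i = Ordinal ltjn by apply: connect0.
  exact: val_inj.
have ltjn' : j < n by lia.
apply: connect_trans (IHj ltjn' lt_ij) _.
by apply: connect1; apply: gen_c; rewrite /ix /=.
Qed.

Lemma latO_chain_a i j : i <= j -> latO_le (Oa i) (Oa j).
Proof. exact: latO_chain. Qed.

Lemma latO_chain_b i j : i <= j -> latO_le (Ob i) (Ob j).
Proof. exact: latO_chain. Qed.

Lemma latO_a_le_t i : latO_le (Oa i) Ot.
Proof.
have ltn : n.-1 < n by have := ltn_ord i; lia.
apply: (connect_trans (latO_chain_a (j := Ordinal ltn) _)) => /=.
  by have := ltn_ord i; lia.
by apply: connect1; rewrite /= /ix /=; lia.
Qed.

Lemma latO_b_le_t i : latO_le (Ob i) Ot.
Proof.
have ltn : n.-1 < n by have := ltn_ord i; lia.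
apply: (connect_trans (latO_chain_b (j := Ordinal ltn) _)) => /=.
  by have := ltn_ord i; lia.
by apply: connect1; rewrite /= /ix /=; lia.
Qed.

Lemma latO_s_le_a i : latO_le Os (Oa i).
Proof.
have ltn : 0 < n by have := ltn_ord i; lia.
apply: (@connect_trans _ _ (Oa (Ordinal ltn))); last exact: latO_chain_a.
by apply: connect1; rewrite /= /ix.
Qed.

Lemma latO_s_le_b i : latO_le Os (Ob i).
Proof.
have ltn : 0 < n by have := ltn_ord i; lia.
apply: (@connect_trans _ _ (Ob (Ordinal ltn))); last exact: latO_chain_b.
by apply: connect1; rewrite /= /ix.
Qed.

Lemma latO_s_le_t : latO_le Os Ot.
Proof.
have [n0|ltn] := posnP n; first by apply: connect1; rewrite /= n0.
by apply: connect_trans (latO_s_le_a (Ordinal ltn)) (latO_a_le_t _).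
Qed.

Lemma latO_a_le_b i j : ix i + ~~ odd (ix i) < ix j -> latO_le (Oa i) (Ob j).
Proof.
move=> lt_ij.
have ltk : i + ~~ odd (ix i) < n by have := ltn_ord j; rewrite /ix in lt_ij *; lia.
have ltl : (i + ~~ odd (ix i)).+1 < n
  by have := ltn_ord j; rewrite /ix in lt_ij *; lia.
apply: (@connect_trans _ _ (Oa (Ordinal ltk))).
  by apply: latO_chain_a => /=; lia.
apply: (@connect_trans _ _ (Ob (Ordinal ltl))).
  by apply: connect1; rewrite /= /ix /=; lia.
by apply: latO_chain_b; rewrite /ix /= in lt_ij *; lia.
Qed.

Lemma latO_b_le_a i j : ix i + odd (ix i) < ix j -> latO_le (Ob i) (Oa j).
Proof.
move=> lt_ij.
have ltk : i + odd (ix i) < n by have := ltn_ord j; rewrite /ix in lt_ij *; lia.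
have ltl : (i + odd (ix i)).+1 < n
  by have := ltn_ord j; rewrite /ix in lt_ij *; lia.
apply: (@connect_trans _ _ (Ob (Ordinal ltk))).
  by apply: latO_chain_b => /=; lia.
apply: (@connect_trans _ _ (Oa (Ordinal ltl))).
  by apply: connect1; rewrite /= /ix /=; lia.
by apply: latO_chain_a; rewrite /ix /= in lt_ij *; lia.
Qed.

Lemma latO_leE x y : latO_le x y = latO_leb x y.
Proof.
apply/idP/idP.
  case/connectP=> p; elim: p x => [x _ ->|z p IHp x] /=.
    exact: latO_leb_refl.
  case/andP=> /latO_gen_leb le_xz path_p def_y.
  exact: latO_leb_trans le_xz (IHp z path_p def_y).
case: x y => [|i|i|] [|j|j|] //=.
- by move=> _; apply: connect0.
- by move=> _; apply: latO_s_le_a.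
- by move=> _; apply: latO_s_le_b.
- by move=> _; apply: latO_s_le_t.
- by move=> le_ij; apply: latO_chain_a.
- exact: latO_a_le_b.
- by move=> _; apply: latO_a_le_t.
- exact: latO_b_le_a.
- by move=> le_ij; apply: latO_chain_b.
- by move=> _; apply: latO_b_le_t.
- by move=> _; apply: connect0.
Qed.

Lemma latO_le_refl : reflexive latO_le.
Proof. by move=> x; apply: connect0. Qed.

Lemma latO_le_anti : antisymmetric latO_le.
Proof. by move=> x y; rewrite !latO_leE; apply: latO_leb_anti. Qed.

Lemma latO_le_trans : transitive latO_le.
Proof. by move=> y x z; apply: connect_trans. Qed.

Definition latO_height x : nat :=
  match x with Os => 0 | Oa i => ix i | Ob i => ix i | Ot => n.+1 end.

(** The maximal chain s < a_1 < b_2 < a_3 < b_4 < ... < t. *)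
Definition latO_zigzag (k : nat) : latO n :=
  if k is k'.+1 then
    if insub k' is Some i then (if odd k then Oa i else Ob i) else Ot
  else Os.

(** The join of two incomparable elements is the element of the chain above
    lying just above both, and dually for the meet. *)
Definition latO_join x y : latO n :=
  if latO_leb x y then y else if latO_leb y x then x
  else latO_zigzag (maxn (latO_height x) (latO_height y)).+1.

Definition latO_meet x y : latO n :=
  if latO_leb x y then x else if latO_leb y x then y
  else latO_zigzag (minn (latO_height x) (latO_height y)).-1.

Variant zigzag_spec k : latO n -> Prop :=
  | ZigS of k = 0 : zigzag_spec k Os
  | ZigA i of k = ix i & odd k : zigzag_spec k (Oa i)
  | ZigB i of k = ix i & ~~ odd k : zigzag_spec k (Ob i)
  | ZigT of n < k : zigzag_spec k Ot.

Lemma zigzagP k : zigzag_spec k (latO_zigzag k).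
Proof.
case: k => [|k]; first exact: ZigS.
rewrite /latO_zigzag; case: insubP => [i _ <-|].
  by case: ifP => odd_i; constructor=> //; rewrite odd_i.
by rewrite -leqNgt => le_nk; apply: ZigT.
Qed.

Lemma latO_leUx x y z :
  latO_le (latO_join x y) z = latO_le x z && latO_le y z.
Proof.
rewrite !latO_leE /latO_join.
case: ifP => [le_xy|nle_xy].
  apply/idP/andP => [le_yz|[]//]; split=> //.
  exact: latO_leb_trans le_xy le_yz.
case: ifP => [le_yx|nle_yx].
  apply/idP/andP => [le_xz|[]//]; split=> //.
  exact: latO_leb_trans le_yx le_xz.
case: zigzagP => [//|k|k|];
  case: x y z nle_xy nle_yx => [|i|i|] [|j|j|] [|l|l|] //=;
  try (have ltl := ltn_ord l); rewrite /ix; lia.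
Qed.

Lemma latO_lexI x y z :
  latO_le x (latO_meet y z) = latO_le x y && latO_le x z.
Proof.
rewrite !latO_leE /latO_meet.
case: ifP => [le_yz|nle_yz].
  apply/idP/andP => [le_xy|[]//]; split=> //.
  exact: latO_leb_trans le_xy le_yz.
case: ifP => [le_zy|nle_zy].
  apply/idP/andP => [le_xz|[]//]; split=> //.
  exact: latO_leb_trans le_xz le_zy.
case: zigzagP => [|k|k|];
  case: y z x nle_yz nle_zy => [|i|i|] [|j|j|] [|l|l|] //=;
  have lti := ltn_ord i; rewrite /ix; lia.
Qed.

Lemma latO_le0x x : latO_le Os x.
Proof. by rewrite latO_leE. Qed.

Lemma latO_lex1 x : latO_le x Ot.
Proof. by rewrite latO_leE; case: x. Qed.

End LatOOrder.

Fact latO_display : Order.disp_t. Proof. exact: (Order.Disp tt tt). Qed.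

Section LatOLattice.
Variable n : nat.

HB.instance Definition _ := Order.Le_isPOrder.Build latO_display (latO n)
  (@latO_le_refl n) (@latO_le_anti n) (@latO_le_trans n).
HB.instance Definition _ :=
  Order.POrder_isMeetSemilattice.Build latO_display (latO n) (@latO_lexI n).
HB.instance Definition _ :=
  Order.POrder_isJoinSemilattice.Build latO_display (latO n) (@latO_leUx n).
HB.instance Definition _ :=
  Order.hasBottom.Build latO_display (latO n) (@latO_le0x n).
HB.instance Definition _ :=
  Order.hasTop.Build latO_display (latO n) (@latO_lex1 n).

End LatOLattice.

(* Main.v *)
Require Import Defs.
From mathcomp Require Import all_boot all_order all_algebra.
From mathcomp Require Import mpoly.
From HB Require Import structures.
From mathcomp Require Import zify.

Set Implicit Arguments.
Unset Strict Implicit.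
Unset Printing Implicit Defensive.

Import Order.TTheory GRing.Theory.

(** The lattice O_n is a staircase in the plane: counting, for each element, how
    many of b_1, b_3, b_5, ... and how many of a_1, a_2, a_4, a_6, ... lie below
    it gives a lattice embedding into N x N with componentwise order
    ([latO_coord]), so O_n is distributive. The theorem is then an instance of
    Hibi's theorem: the join-meet ideal of a finite distributive lattice is the
    kernel of a morphism into a polynomial ring over K, hence prime, hence
    radical.

    The morphism sends x_a to the product of the variables t_j over the
    join-prime elements j <= a. It kills the generators because
    [j <= a] + [j <= b] = [j <= a v b] + [j <= a ^ b] for j join-prime
    ([hibi_exp_joinmeet]). For the converse inclusion, call a monomial a
    multichain when the elements of L it involves are pairwise comparable.
    Replacing x_a x_b by x_(a v b) x_(a ^ b) for incomparable a and b pushes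
    monomials away from the middle of the lattice and terminates, so every
    polynomial is congruent to a combination of multichains modulo the ideal
    ([straighten]). The morphism sends monomials to monomials, and it is
    injective on multichains ([hibi_mono_inj]): join-primes separate the
    elements of a distributive lattice, so the largest element of a multichain
    is determined by the set of t_j occurring in the image; divide by it and
    repeat. Hence a combination of multichains in the kernel is zero, and the
    kernel is no larger than the ideal ([join_meet_ideal_ker]). *)

(** * Ideals generated by a finite family *)

Section GeneratedIdeal.
Local Open Scope ring_scope.
Variables (R : comNzRingType) (I : finType) (g : I -> R).

Lemma generated_ideal0 : generated_ideal g 0.
Proof.
by exists (fun=> 0); rewrite big1 // => i _; rewrite mul0r.
Qed.

Lemma generated_idealD p q :
  generated_ideal g p -> generated_ideal g q -> generated_ideal g (p + q).
Proof.
move=> [c ->] [e ->]; exists (fun i => c i + e i).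
by rewrite -big_split; apply: eq_bigr => i _; rewrite mulrDl.
Qed.

Lemma generated_idealM r p :
  generated_ideal g p -> generated_ideal g (r * p).
Proof.
move=> [c ->]; exists (fun i => r * c i).
by rewrite mulr_sumr; apply: eq_bigr => i _; rewrite mulrA.
Qed.

Lemma generated_ideal_gen i : generated_ideal g (g i).
Proof.
exists (fun j => (j == i)%:R); rewrite (bigD1 i) //= eqxx mul1r big1 ?addr0 //.
by move=> j /negbTE ->; rewrite mul0r.
Qed.

Lemma generated_ideal_trans p q r :
  generated_ideal g (p - q) -> generated_ideal g (q - r) ->
  generated_ideal g (p - r).
Proof. by move=> gpq gqr; rewrite -(subrKA q); apply: generated_idealD. Qed.

End GeneratedIdeal.

(** * Multichain monomials span the quotient by the join-meet ideal *)

Section Straightening.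
Variables (d : Order.disp_t) (L : finLatticeType d).
Implicit Types (a b x y : L) (m : 'X_{1..#|L|}).

Definition multichain m : bool := [forall a, forall b,
  (0 < m (enum_rank a)) ==> (0 < m (enum_rank b))
  ==> ((a <= b)%O || (b <= a)%O)].

Definition downsize a : nat := #|[set x : L | (x <= a)%O]|.

Lemma downsize_lt a b : (a < b)%O -> downsize a < downsize b.
Proof.
move=> lt_ab; apply: proper_card; apply/properP; split.
  by apply/subsetP=> x; rewrite !inE => /le_trans-> //; apply: ltW.
by exists b; rewrite inE ?lexx ?(lt_geF lt_ab).
Qed.

(** Strictly monotone with steps that double: since a v b lies strictly above
    two incomparable elements a and b, 2 ^ downsize (a v b) alone is at least
    2 ^ downsize a + 2 ^ downsize b, and a ^ b contributes a positive amount.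
    Subtracting from an upper bound makes straightening decrease the weight. *)
Definition weight a : nat := 2 ^ #|L| - 2 ^ downsize a.

Lemma weight_joinmeet a b : ~~ ((a <= b)%O || (b <= a)%O) ->
  weight (a `|` b)%O + weight (a `&` b)%O
  < weight a + weight b.
Proof.
rewrite negb_or => /andP[nab nba].
have lt_a : downsize a < downsize (a `|` b)%O.
  by apply: downsize_lt; rewrite lt_neqAle leUl andbT eq_sym eq_joinl.
have lt_b : downsize b < downsize (a `|` b)%O.
  by apply: downsize_lt; rewrite lt_neqAle leUr andbT eq_sym eq_joinr.
have le_pow x : 2 ^ downsize x <= 2 ^ #|L|.
  by rewrite leq_exp2l // max_card.
have := le_pow a; have := le_pow b; have := le_pow (a `|` b)%O.
have := le_pow (a `&` b)%O.
have : 2 ^ (downsize a).+1 <= 2 ^ downsize (a `|` b)%O by rewrite leq_exp2l.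
have : 2 ^ (downsize b).+1 <= 2 ^ downsize (a `|` b)%O by rewrite leq_exp2l.
have : 0 < 2 ^ downsize (a `&` b)%O by rewrite expn_gt0.
by rewrite /weight !expnS; lia.
Qed.

Definition mono_weight m : nat :=
  \sum_a m (enum_rank a) * weight a.

Lemma mono_weightD m1 m2 :
  mono_weight (m1 + m2)%MM = mono_weight m1 + mono_weight m2.
Proof.
by rewrite -big_split; apply: eq_bigr => a _ /=; rewrite mnmDE mulnDl.
Qed.

Lemma mono_weight1 a : mono_weight U_(enum_rank a)%MM = weight a.
Proof.
rewrite /mono_weight (bigD1 a) //= mnm1E eqxx mul1n big1 ?addn0 // => b nba.
by rewrite mnm1E (inj_eq enum_rank_inj) eq_sym (negbTE nba).
Qed.

Variable K : fieldType.
Local Open Scope ring_scope.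

(** Termination of the rewriting x_a x_b -> x_(a v b) x_(a ^ b), by induction
    on the weight. *)
Lemma straighten_monomial m : exists2 m' : 'X_{1..#|L|}, multichain m' &
  join_meet_ideal K L ('X_[m] - 'X_[m']).
Proof.
have [k] := ubnP (mono_weight m); elim: k m => // k IHk m le_mk.
have [chain_m | ] := boolP (multichain m).
  by exists m => //; rewrite subrr; apply: generated_ideal0.
rewrite negb_forall => /existsP[a]; rewrite negb_forall => /existsP[b].
rewrite !negb_imply => /and3P[ma mb nab].
have neq_ab : a != b by apply: contraNneq nab => ->; rewrite lexx.
pose m0 := (m - (U_(enum_rank a) + U_(enum_rank b)))%MM.
have def_m : m = (U_(enum_rank a) + U_(enum_rank b) + m0)%MM.
  apply/mnmP=> i; rewrite !mnmDE mnmBE mnmDE !mnm1E addnC subnK //.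
  have [<-|_] := eqVneq (enum_rank a) i.
    by rewrite (inj_eq enum_rank_inj) eq_sym (negbTE neq_ab).
  by have [<-|] := eqVneq (enum_rank b) i.
pose m1 : 'X_{1..#|L|} :=
  (U_(enum_rank (a `|` b)%O) + U_(enum_rank (a `&` b)%O) + m0)%MM.
have [|m' chain_m' m1m'] := IHk m1.
  apply: (@leq_trans (mono_weight m)) => //.
  rewrite [in ltnRHS]def_m !mono_weightD.
  by rewrite !mono_weight1 ltn_add2r weight_joinmeet.
exists m' => //; apply: generated_ideal_trans m1m'.
have -> : 'X_[m] - 'X_[m1] = 'X_[m0] * join_meet_gen K (a, b).
  by rewrite def_m !mpolyXD -mulrBl mulrC.
exact: generated_idealM (generated_ideal_gen _ _).
Qed.

Lemma straighten (p : {mpoly K[#|L|]}) : exists2 q,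
  {in msupp q, forall m, multichain m} & join_meet_ideal K L (p - q).
Proof.
elim/mpolyind: p => [|c m p _ _ [q chain_q pq]].
  by exists 0 => [m|]; rewrite ?subrr ?msupp0 //; apply: generated_ideal0.
have [m' chain_m' mm'] := straighten_monomial m.
exists (c *: 'X_[m'] + q) => [k|].
  move/msuppD_le; rewrite mem_cat => /orP[|/chain_q//].
  by move/msuppZ_le; rewrite msuppX inE => /eqP->.
rewrite opprD addrACA -scalerBr -mul_mpolyC.
by apply: generated_idealD => //; apply: generated_idealM.
Qed.

End Straightening.

(** * Hibi's parametrisation of a finite distributive lattice *)

Section HibiMap.
Variables (d : Order.disp_t) (L : finTBDistrLatticeType d).
Implicit Types (a b j x y : L) (m : 'X_{1..#|L|}).

Definition join_prime j : bool :=
  [forall x, forall y, (j <= x `|` y)%O ==> (j <= x)%O || (j <= y)%O].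

Lemma join_primeU j x y :
  join_prime j -> (j <= x `|` y)%O = (j <= x)%O || (j <= y)%O.
Proof.
move=> /forallP/(_ x)/forallP/(_ y)/implyP prime_j.
apply/idP/idP => // /orP[] /le_trans; apply; [exact: leUl | exact: leUr].
Qed.

(** With this convention the bottom element is join-prime: its variable records
    the total degree, and so tells the monomial 1 apart from powers of
    x_bottom, which no other join-prime sees. *)
Lemma join_prime0 : join_prime (Order.bottom : L).
Proof. by do 2!apply/forallP=> ?; rewrite !le0x. Qed.

(** Among the elements below x but not below y, a minimal one j is join-prime.
    If j <= u v v, distributivity gives j = (j ^ u) v (j ^ v); were both terms
    strictly below j, minimality would put both, hence j, below y. *)
Lemma join_prime_sep x y :
  ~~ (x <= y)%O -> exists j, [/\ join_prime j, (j <= x)%O & ~~ (j <= y)%O].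
Proof.
move=> nxy; pose P j := (j <= x)%O && ~~ (j <= y)%O.
have Px : P x by rewrite /P lexx.
case: (arg_minnP (@downsize d L) Px) => j /andP[le_jx nle_jy] min_j.
exists j; split=> //; apply/forallP=> u; apply/forallP=> v.
apply/implyP=> le_juv.
have below w : ~~ (j <= w)%O -> (j `&` w <= y)%O.
  move=> nle_jw; apply: contraTT (isT : true) => nle_y.
  have := min_j (j `&` w)%O; rewrite /P (le_trans (leIl _ _) le_jx) nle_y.
  move=> /(_ isT); rewrite leqNgt downsize_lt // lt_neqAle leIl andbT.
  by apply: contra nle_jw => /eqP <-; rewrite leIr.
apply: contraR nle_jy; rewrite negb_or => /andP[/below ju /below jv].
have -> : j = ((j `&` u) `|` (j `&` v))%O by rewrite -meetUr meet_l.
by rewrite leUx ju jv.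
Qed.

(** The exponent of the product of the t_j over the join-primes j <= a, where
    t_j is the variable of index the rank of j. All of L indexes the target
    variables, which spares a subtype of join-primes. *)
Definition hibi_exp a : 'X_{1..#|L|} :=
  [multinom nat_of_bool (join_prime (enum_val i) && (enum_val i <= a)%O)
    | i < #|L|].

Lemma hibi_expE a j :
  hibi_exp a (enum_rank j) = join_prime j && (j <= a)%O.
Proof. by rewrite mnmE enum_rankK. Qed.

Lemma hibi_exp_joinmeet a b :
  (hibi_exp a + hibi_exp b = hibi_exp (a `|` b)%O + hibi_exp (a `&` b)%O)%MM.
Proof.
apply/mnmP=> i; rewrite !mnmDE !mnmE.
case prime_j: (join_prime _) => //=; rewrite join_primeU // lexI.
by do 2!case: (_ <= _)%O.
Qed.

Definition hibi_mono m : 'X_{1..#|L|} :=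
  (\sum_(i < #|L|) hibi_exp (enum_val i) *+ m i)%MM.

Lemma hibi_monoE m j : hibi_mono m (enum_rank j) =
  \sum_a (join_prime j && (j <= a)%O) * m (enum_rank a).
Proof.
rewrite mnm_sumE (reindex (@enum_rank L)) /=; last first.
  exact: (onW_bij _ (@enum_rank_bij L)).
by apply: eq_bigr => a _; rewrite mulmnE enum_rankK hibi_expE.
Qed.

Lemma hibi_monoD m1 m2 :
  hibi_mono (m1 + m2) = (hibi_mono m1 + hibi_mono m2)%MM.
Proof.
rewrite -big_split; apply: eq_bigr => i _; apply/mnmP=> k /=.
by rewrite mnmDE !mulmnE !mnmDE !mulmnE mulnDr.
Qed.

Lemma hibi_mono1 a : hibi_mono U_(enum_rank a)%MM = hibi_exp a.
Proof.
rewrite /hibi_mono (bigD1 (enum_rank a)) //= mnm1E eqxx enum_rankK mulm1n.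
rewrite big1 ?addm0 // => i /negbTE nia.
by rewrite mnm1E eq_sym nia mulm0n.
Qed.

(** For a multichain this says that t_j occurs in the image iff j lies below the
    largest element, which is how that element is recovered. *)
Lemma hibi_mono_gt0 m j : join_prime j -> reflect
  (exists2 a, (j <= a)%O & 0 < m (enum_rank a))
  (0 < hibi_mono m (enum_rank j)).
Proof.
move=> prime_j; rewrite hibi_monoE prime_j lt0n sum_nat_eq0 negb_forall.
apply: (iffP existsP) => [[a]|[a le_ja ma]].
  by rewrite -lt0n muln_gt0 lt0b => /andP[le_ja ma]; exists a.
by exists a; rewrite -lt0n muln_gt0 lt0b le_ja.
Qed.

Lemma multichain_top m a0 : multichain m -> 0 < m (enum_rank a0) ->
  exists2 a, 0 < m (enum_rank a) & forall b, 0 < m (enum_rank b) -> (b <= a)%O.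
Proof.
move=> chain_m ma0.
case: (@arg_maxnP _ _ (fun a => 0 < m (enum_rank a)) (@downsize d L) ma0).
move=> a ma max_a; exists a => // b mb.
have := chain_m => /forallP/(_ a)/forallP/(_ b).
rewrite ma mb /= => /orP[|//]; rewrite le_eqVlt => /orP[/eqP->//|].
by move/downsize_lt; rewrite ltnNge (max_a b mb : _ <= _).
Qed.

(** Multichains with the same image have the same largest element: otherwise a
    join-prime below one of the two and not below the other would occur in only
    one of the images. *)
Lemma hibi_mono_top m1 m2 a0 : multichain m1 -> multichain m2 ->
  hibi_mono m1 = hibi_mono m2 -> 0 < m1 (enum_rank a0) ->
  exists2 a, 0 < m1 (enum_rank a) & 0 < m2 (enum_rank a).
Proof.
move=> chain1 chain2 eq12 m1a0.
have [a m1a top_a] := multichain_top chain1 m1a0.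
have [b0 _ m2b0] : exists2 b, (Order.bottom <= b)%O & 0 < m2 (enum_rank b).
  apply/(hibi_mono_gt0 _ join_prime0); rewrite -eq12.
  by apply/(hibi_mono_gt0 _ join_prime0); exists a; rewrite ?le0x.
have [b m2b top_b] := multichain_top chain2 m2b0.
suff eq_ab : a = b by exists a; rewrite // eq_ab.
apply/eqP; rewrite eq_le; apply/andP; split; apply/negPn/negP.
  move=> /join_prime_sep[j [prime_j le_ja /negP[]]].
  have /(hibi_mono_gt0 _ prime_j)[c le_jc /top_b] :
    0 < hibi_mono m2 (enum_rank j); last exact: le_trans.
  by rewrite -eq12; apply/(hibi_mono_gt0 _ prime_j); exists a.
move=> /join_prime_sep[j [prime_j le_jb /negP[]]].
have /(hibi_mono_gt0 _ prime_j)[c le_jc /top_a] :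
  0 < hibi_mono m1 (enum_rank j); last exact: le_trans.
by rewrite eq12; apply/(hibi_mono_gt0 _ prime_j); exists b.
Qed.

Lemma multichain_addr m1 m2 : multichain (m1 + m2)%MM -> multichain m2.
Proof.
move=> /forallP chain12; apply/forallP=> a; apply/forallP=> b.
have /forallP/(_ b) := chain12 a; rewrite !mnmDE.
apply: contraTT; rewrite !negb_imply => /and3P[m2a m2b ->].
by rewrite !addn_gt0 m2a m2b !orbT.
Qed.

Lemma mnm_gt0_split m i : 0 < m i -> m = (U_(i) + (m - U_(i)))%MM.
Proof.
move=> mi; rewrite addmC submK //; apply/mnm_lepP=> k.
by rewrite mnm1E; case: eqP => // <-.
Qed.

(** Induction on the degree: the common largest element can be cancelled from
    both multichains, and from their images. *)
Lemma hibi_mono_inj m1 m2 : multichain m1 -> multichain m2 ->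
  hibi_mono m1 = hibi_mono m2 -> m1 = m2.
Proof.
have [k] := ubnP (mdeg m1); elim: k m1 m2 => // k IHk m1 m2.
move=> le_m1k chain1 chain2 eq12.
have [a0 m1a0 | m1_0] := pickP (fun a => 0 < m1 (enum_rank a)); last first.
  have [a0 m2a0 | m2_0] := pickP (fun a => 0 < m2 (enum_rank a)).
    have [a _] := hibi_mono_top chain2 chain1 (esym eq12) m2a0.
    by rewrite m1_0.
  apply/mnmP=> i; have := m1_0 (enum_val i); have := m2_0 (enum_val i).
  by rewrite enum_valK; case: (m1 i) (m2 i) => [|?] [|?].
have [a m1a m2a] := hibi_mono_top chain1 chain2 eq12 m1a0.
move: le_m1k chain1 chain2 eq12.
rewrite (mnm_gt0_split m1a) (mnm_gt0_split m2a) mdegD mdeg1 ltnS.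
set n1 := (m1 - _)%MM; set n2 := (m2 - _)%MM.
move=> lt_n1k /multichain_addr chain1 /multichain_addr chain2.
by rewrite !hibi_monoD => /addmI /(IHk _ _ lt_n1k chain1 chain2) ->.
Qed.

Variable K : fieldType.
Local Open Scope ring_scope.

Definition hibi_map : {mpoly K[#|L|]} -> {mpoly K[#|L|]} :=
  mmap (@mpolyC _ K) (fun i => 'X_[hibi_exp (enum_val i)]).

HB.instance Definition _ := GRing.RMorphism.on hibi_map.

Lemma hibi_mapX m : hibi_map 'X_[m] = 'X_[hibi_mono m].
Proof.
rewrite /hibi_map mmapX /mmap1 /hibi_mono.
rewrite (big_morph _ (@mpolyXD _ _) (@mpolyX0 _ _)).
by apply: eq_bigr => i _; rewrite mpolyXn.
Qed.

Lemma hibi_mapZ c p : hibi_map (c *: p) = c *: hibi_map p.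
Proof. by rewrite /hibi_map mmapZ mul_mpolyC. Qed.

Lemma hibi_map_gen ab : hibi_map (join_meet_gen K ab) = 0.
Proof.
rewrite /join_meet_gen /latvar -!mpolyXD rmorphB /= !hibi_mapX.
rewrite !hibi_monoD !hibi_mono1.
by rewrite hibi_exp_joinmeet subrr.
Qed.

(** Distinct multichains have distinct monomial images, so each coefficient of
    p is also a coefficient of its image. *)
Lemma hibi_map_inj_multichain (p : {mpoly K[#|L|]}) :
  {in msupp p, forall m, multichain m} -> hibi_map p = 0 -> p = 0.
Proof.
move=> chain_p p0; apply/mpolyP=> m; rewrite mcoeff0.
have [supp_m|/memN_msupp_eq0//] := boolP (m \in msupp p).
have := congr1 (mcoeff (hibi_mono m)) p0.
rewrite mcoeff0 {1}[p]mpolyE rmorph_sum raddf_sum => <-.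
rewrite (bigD1_seq m) ?msupp_uniq //= hibi_mapZ mcoeffZ hibi_mapX mcoeffX.
rewrite eqxx mulr1 big1_seq ?addr0 // => m' /andP[nm' supp_m'].
rewrite hibi_mapZ mcoeffZ hibi_mapX mcoeffX.
case: eqP => [eq_m|]; last by rewrite mulr0.
by rewrite (hibi_mono_inj _ _ eq_m) ?eqxx ?chain_p in nm'.
Qed.

Lemma hibi_map_ideal (p : {mpoly K[#|L|]}) :
  join_meet_ideal K L p -> hibi_map p = 0.
Proof.
move=> [c ->]; rewrite rmorph_sum big1 // => ab _.
by rewrite rmorphM /= hibi_map_gen mulr0.
Qed.

Lemma join_meet_ideal_ker (p : {mpoly K[#|L|]}) :
  join_meet_ideal K L p <-> hibi_map p = 0.
Proof.
split=> [|p0]; first exact: hibi_map_ideal.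
have [q chain_q pq] := straighten p.
suff q0 : q = 0 by rewrite q0 subr0 in pq.
apply: hibi_map_inj_multichain => //.
by rewrite -[q](subKr p) rmorphB /= p0 hibi_map_ideal ?subr0.
Qed.

(** The ideal is the kernel of a morphism into an integral domain. *)
Lemma join_meet_ideal_radical : is_radical (join_meet_ideal K L).
Proof.
move=> p; split=> [[k k_gt0 /join_meet_ideal_ker]|]; last by exists 1%N.
move=> pk0; apply/join_meet_ideal_ker; apply/eqP; move/eqP: pk0.
by rewrite rmorphXn expf_eq0 k_gt0.
Qed.

End HibiMap.

(** * O_n is a distributive lattice *)

Section LatODistributive.
Variable n : nat.
Implicit Types x y z : latO n.

(** The join-primes of O_n other than s form the two chains
    b_1 < b_3 < b_5 < ... and a_1 < a_2 < a_4 < a_6 < ...; the coordinates count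
    how many members of each lie below x. *)
Definition latO_coord x : nat * nat :=
  match x with
  | Os => (0, 0)
  | Oa i => (i./2, i.+1./2.+1)
  | Ob i => (i./2.+1, i.+1./2)
  | Ot => (n.+1./2, n./2.+1)
  end.

Lemma latO_leE_coord x y : (x <= y)%O =
  ((latO_coord x).1 <= (latO_coord y).1)
  && ((latO_coord x).2 <= (latO_coord y).2).
Proof.
rewrite [LHS]latO_leE.
by case: x y => [|[i lt_i]|[i lt_i]|] [|[j lt_j]|[j lt_j]|] //=; lia.
Qed.

(** The k-th element of the chain s < a_1 < b_2 < a_3 < ... has coordinates
    (k/2, (k+1)/2) rounded down, and the join of two incomparable elements is
    the member of that chain just above both. *)
Lemma latO_coordU x y : latO_coord (x `|` y)%O =
  (maxn (latO_coord x).1 (latO_coord y).1,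
   maxn (latO_coord x).2 (latO_coord y).2).
Proof.
have [le_xy|nle_xy] := boolP (x <= y)%O.
  rewrite join_r //; move: le_xy; rewrite latO_leE_coord => /andP[].
  by move=> /maxn_idPr-> /maxn_idPr->; case: latO_coord.
have [le_yx|nle_yx] := boolP (y <= x)%O.
  rewrite join_l //; move: le_yx; rewrite latO_leE_coord => /andP[].
  by move=> /maxn_idPl-> /maxn_idPl->; case: latO_coord.
rewrite -[(x `|` y)%O]/(latO_join x y) /latO_join -!latO_leE.
rewrite (negbTE nle_xy : latO_le x y = false).
rewrite (negbTE nle_yx : latO_le y x = false).
move: nle_xy nle_yx; rewrite !latO_leE_coord.
case: zigzagP => [|[k lt_k]|[k lt_k]|];
  case: x y => [|[i lt_i]|[i lt_i]|] [|[j lt_j]|[j lt_j]|] //=;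
  move=> *; congr (_, _); lia.
Qed.

Lemma latO_coordI x y : latO_coord (x `&` y)%O =
  (minn (latO_coord x).1 (latO_coord y).1,
   minn (latO_coord x).2 (latO_coord y).2).
Proof.
have [le_xy|nle_xy] := boolP (x <= y)%O.
  rewrite meet_l //; move: le_xy; rewrite latO_leE_coord => /andP[].
  by move=> /minn_idPl-> /minn_idPl->; case: latO_coord.
have [le_yx|nle_yx] := boolP (y <= x)%O.
  rewrite meet_r //; move: le_yx; rewrite latO_leE_coord => /andP[].
  by move=> /minn_idPr-> /minn_idPr->; case: latO_coord.
rewrite -[(x `&` y)%O]/(latO_meet x y) /latO_meet -!latO_leE.
rewrite (negbTE nle_xy : latO_le x y = false).
rewrite (negbTE nle_yx : latO_le y x = false).
move: nle_xy nle_yx; rewrite !latO_leE_coord.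
case: zigzagP => [|[k lt_k]|[k lt_k]|];
  case: x y => [|[i lt_i]|[i lt_i]|] [|[j lt_j]|[j lt_j]|] //=;
  move=> *; congr (_, _); lia.
Qed.

Lemma latO_meetUl : left_distributive (@Order.meet _ (latO n)) Order.join.
Proof.
move=> x y z; apply/eqP; rewrite eq_le !latO_leE_coord.
by rewrite !(latO_coordU, latO_coordI) /=; lia.
Qed.

HB.instance Definition _ :=
  Order.Lattice_Meet_isDistrLattice.Build latO_display (latO n) latO_meetUl.

End LatODistributive.

Theorem theorem1p4 (K : fieldType) (n : nat) (hn : (1 <= n)%N) :
  is_radical (join_meet_ideal K (latO n)).
Proof. exact: join_meet_ideal_radical. Qed.
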